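(* Let $G$ be a finite, connected, undirected multigraph without loops, and fix distinct vertices $x,y$ of $G$. Let $G_1$ be the multigraph obtained from $G$ by either adding one edge between $x$ and $y$ or removing one edge between $x$ and $y$, and assume $G_1$ is connected. Let $\langle[\delta_{xy}]\rangle$ denote the subgroup of $\mathrm{Jac}(G)$ generated by $[\delta_{xy}]$. Then $$[\mathrm{Jac}(G):\langle[\delta_{xy}]\rangle]\ \Big|\ \gcd(|\mathrm{Jac}(G)|,|\mathrm{Jac}(G_1)|)$$ and $$\gcd(|\mathrm{Jac}(G)|,|\mathrm{Jac}(G_1)|)\ \Big|\ [\mathrm{Jac}(G):\langle[\delta_{xy}]\rangle]^2.$$
   Context: For a finite connected loopless multigraph $H$ with vertex set $V(H)$: a divisor is an element of $\mathbb{Z}^{V(H)}$ (an integer assigned to each vertex); its degree is the sum of its values; $\mathrm{Div}^0(H)$ is the group of degree-zero divisors. The Laplacian is $L=\Delta-A$, where $\Delta$ is the diagonal matrix of vertex valencies (number of incident edges) and $A_{vw}$ is the number of edges between $v$ and $w$. Principal divisors are those of the form $L\sigma$ with $\sigma\in\mathbb{Z}^{V(H)}$ (obtained by chip-firing), and $\mathrm{Jac}(H)=\mathrm{Div}^0(H)/\{L\sigma\}$; it is a finite abelian group whose order equals the number of spanning trees of $H$. For vertices $x\neq y$, $\delta_{xy}$ is the divisor with value $-1$ at $x$, $1$ at $y$ and $0$ elsewhere, and $[\delta_{xy}]$ is its class in the Jacobian. *)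

(* Defs.v *)
From HB Require Import structures.
From mathcomp Require Import all_boot all_order all_algebra all_fingroup.
From mathcomp Require Import boolp.

Set Implicit Arguments.
Unset Strict Implicit.
Unset Printing Implicit Defensive.
Import Order.TTheory GRing.Theory Num.Theory.
Local Open Scope ring_scope.
Local Open Scope quotient_scope.

(* Requiring [ends e] to be a two-element set makes edges undirected and rules out loops. *)
Record multigraph (V : finType) := Multigraph {
  edge : finType;
  ends : edge -> {set V};
  card_ends : forall e, #|ends e| == 2%N }.
Arguments card_ends {V} m e.

Section Multigraph.
Variables (V : finType) (G : multigraph V).

Definition mult (v w : V) : nat := #|[set e : edge G | ends e == [set v; w]]|.

Definition valency (v : V) : nat := #|[set e : edge G | v \in ends e]|.

Definition adjacent : rel V := [rel v w | (0 < mult v w)%N].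

Definition connectedb : bool :=
  (0 < #|V|)%N && [forall v, forall w, connect adjacent v w].

Definition laplacian (v w : V) : int :=
  (if v == w then (valency v)%:Z else 0) - (mult v w)%:Z.

Section AddEdge.
Variables (x y : V) (neq_xy : x != y).

Definition add_ends (e : option (edge G)) : {set V} :=
  if e is Some e' then ends e' else [set x; y].

Fact card_add_ends e : #|add_ends e| == 2%N.
Proof. by case: e => [e|]; [exact: card_ends | rewrite /= cards2 neq_xy]. Qed.

Definition add_edge : multigraph V := Multigraph card_add_ends.
End AddEdge.

Definition del_edge (e : edge G) : multigraph V :=
  @Multigraph V {e' : edge G | e' != e} (fun e' => ends (val e'))
    (fun e' => card_ends G (val e')).

End Multigraph.

Record cmultigraph (V : finType) := CMultigraph {
  cmultigraph_graph :> multigraph V;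
  cmultigraph_connected : connectedb cmultigraph_graph }.

Section Divisors.
Variable V : finType.

Notation divisor := {ffun V -> int}.

Definition divdeg (D : divisor) : int := \sum_v D v.

Definition deg0 : {pred divisor} := fun D => divdeg D == 0.

Fact deg0_zmod_closed : zmod_closed deg0.
Proof.
split=> [|D E /eqP D0 /eqP E0]; apply/eqP; rewrite /divdeg.
  by rewrite big1 // => v _; rewrite ffunE.
under eq_bigr do rewrite !ffunE.
by rewrite sumrB -/(divdeg D) -/(divdeg E) D0 E0 subrr.
Qed.
HB.instance Definition _ := GRing.isZmodClosed.Build divisor deg0 deg0_zmod_closed.

Record Div0 := MkDiv0 { div0_val :> divisor; div0P : div0_val \in deg0 }.
HB.instance Definition _ := [isSub for div0_val].
HB.instance Definition _ := [Countable of Div0 by <:].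
HB.instance Definition _ := [SubChoice_isSubZmodule of Div0 by <:].

Fact delta_deg0 (x y : V) :
  [ffun v => (v == y)%:Z - (v == x)%:Z] \in deg0.
Proof.
apply/eqP; rewrite /divdeg; under eq_bigr do rewrite ffunE.
have sum1 z : \sum_v (v == z)%:Z = 1.
  by rewrite (bigD1 z) //= eqxx big1 ?addr0 // => v /negPf ->.
by rewrite sumrB !sum1 subrr.
Qed.
Definition delta (x y : V) : Div0 := MkDiv0 (delta_deg0 x y).

End Divisors.
Notation divisor V := {ffun V -> int}.

Section Jacobian.
Variables (V : finType).

Definition lap_op (G : multigraph V) (s : divisor V) : divisor V :=
  [ffun v => \sum_w laplacian G v w * s w].

Definition principal (G : multigraph V) : {pred Div0 V} :=
  fun D => `[< exists s : divisor V, div0_val D = lap_op G s >].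

Fact principal_zmod_closed G : zmod_closed (principal G).
Proof.
split=> [|D E /asboolP[s Ds] /asboolP[t Et]]; apply/asboolP.
  exists 0; apply/ffunP=> v; rewrite !ffunE big1 // => w _.
  by rewrite ffunE mulr0.
exists (s - t); apply/ffunP=> v.
have -> : div0_val (D - E) = div0_val D - div0_val E by [].
rewrite Ds Et !ffunE -sumrB.
by apply: eq_bigr => w _; rewrite !ffunE mulrBr.
Qed.
HB.instance Definition _ G :=
  GRing.isZmodClosed.Build (Div0 V) (principal G) (principal_zmod_closed G).

Definition Jac (G : cmultigraph V) : Type := Quotient.quot (principal G).
HB.instance Definition _ G := GRing.Zmodule.on (Jac G).
HB.instance Definition _ G : isCountable (Jac G) :=
  CanIsCountable (@reprK _ (Quotient.quot (principal G))).

Definition Jac_class (G : cmultigraph V) (D : Div0 V) : Jac G :=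
  \pi_(Quotient.quot (principal G)) D.

Lemma Jac_classP (G : cmultigraph V) (D : Div0 V) :
  Jac_class G D = 0 <-> D \in principal G.
Proof.
rewrite /Jac_class; split=> [|DG].
  rewrite -[0](@pi_zeror _ _ _ _ _ (Quotient.quot (principal G))) => /eqP.
  by rewrite -Quotient.idealrBE subr0.
rewrite -[0](@pi_zeror _ _ _ _ _ (Quotient.quot (principal G))); apply/eqP.
by rewrite -Quotient.idealrBE subr0.
Qed.

Fact Jac_class_is_zmod_morphism (G : cmultigraph V) :
  zmod_morphism (@Jac_class G).
Proof. by move=> D E; rewrite /Jac_class raddfB. Qed.
HB.instance Definition _ G :=
  GRing.isZmodMorphism.Build (Div0 V) (Jac G) (@Jac_class G)
    (Jac_class_is_zmod_morphism G).

Fact Jac_class_surj (G : cmultigraph V) (a : Jac G) :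
  exists D, a = Jac_class G D.
Proof. by exists (generic_quotient.repr a); rewrite /Jac_class reprK. Qed.

Lemma mult_sym (G : multigraph V) v w : mult G v w = mult G w v.
Proof. by rewrite /mult; apply: eq_card => e; rewrite !inE setUC. Qed.

Lemma laplacian_sym (G : multigraph V) v w : laplacian G v w = laplacian G w v.
Proof. by rewrite /laplacian mult_sym; case: eqVneq => // ->. Qed.

Lemma valency_sum (G : multigraph V) v : valency G v = (\sum_w mult G v w)%N.
Proof.
rewrite /valency /mult -sum1_card.
under [RHS]eq_bigr do rewrite -sum1_card.
under [RHS]eq_bigr do under eq_bigl do rewrite inE.
rewrite (exchange_big_dep (fun e => v \in ends e)) /=; last first.
  by move=> w e _ /eqP->; rewrite set21.
rewrite (eq_bigl (fun e => v \in ends e)); last by move=> e; rewrite inE.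
apply: eq_bigr => e ve.
have /eqP/cards2P[a [b [ab eab]]] := eqP (card_ends G e).
rewrite eab in ve *.
have [c cv vc] : exists2 c, c != v & [set a; b] = [set v; c].
  by move: ve; rewrite !inE => /orP[/eqP->|/eqP->];
    [exists b; rewrite // eq_sym | exists a; rewrite // setUC].
rewrite (eq_bigl (pred1 c)) ?big_pred1_eq // => w /=.
rewrite vc; apply/eqP/eqP => [/setP/(_ c)|->//].
by rewrite !inE eqxx orbT (negPf cv) /= => /esym/eqP.
Qed.

Lemma laplacian_apply (G : multigraph V) (s : divisor V) v :
  lap_op G s v = \sum_w (mult G v w)%:Z * (s v - s w).
Proof.
rewrite ffunE /laplacian.
under eq_bigr do rewrite mulrBl; rewrite sumrB.
under [RHS]eq_bigr do rewrite mulrBr; rewrite sumrB; congr (_ - _).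
rewrite (bigD1 v) //= eqxx big1 ?addr0 => [|w /negPf]; last first.
  by rewrite eq_sym => ->; rewrite mul0r.
by rewrite -mulr_suml valency_sum (big_morph Posz PoszD erefl).
Qed.

Lemma divdeg_lap_op (G : multigraph V) (s : divisor V) :
  divdeg (lap_op G s) = 0.
Proof.
have: divdeg (lap_op G s) = - divdeg (lap_op G s).
  rewrite /divdeg; under eq_bigr do rewrite laplacian_apply.
  rewrite {2}exchange_big /= -sumrN; apply: eq_bigr => v _.
  rewrite -sumrN; apply: eq_bigr => w _.
  by rewrite mult_sym -mulrN opprB.
by move/eqP; rewrite -addr_eq0 -mulr2n mulrn_eq0 => /eqP.
Qed.

Lemma lap_op_eq0 (G : cmultigraph V) (s : divisor V) :
  lap_op G s = 0 -> forall v w, s v = s w.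
Proof.
case: G => G /= /andP[/card_gt0P[v0 _] /forallP Gc] Ls0.
pose m := [arg max_(v > v0) s v]%O.
have le_m v : s v <= s m by rewrite /m; case: arg_maxP => // u _; exact.
suff sm v : s v = s m by move=> v w; rewrite !sm.
have [p mp ->] := connectP (forallP (Gc m) v).
elim/last_ind: p mp => //= p u IHp; rewrite rcons_path last_rcons.
case/andP=> /IHp {}IHp /=; set t := last m p in IHp * => tu.
have /eqP := congr1 (fun D : divisor V => D t) Ls0.
rewrite laplacian_apply ffunE psumr_eq0; last first.
  by move=> w _; rewrite mulr_ge0 // subr_ge0 IHp.
move/allP/(_ u (mem_index_enum _)); rewrite mulf_eq0 subr_eq0 IHp.
by case/orP=> [|/eqP//]; rewrite eqz_nat eqn0Ngt (tu : (0 < mult G t u)%N).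
Qed.

Lemma ffunMz (D : divisor V) (z : int) v : (D *~ z) v = D v * z.
Proof.
case: z => k; first by rewrite -pmulrn ffunMnE -mulr_natr natz.
by rewrite NegzE mulrNz ffunE -pmulrn ffunMnE mulrN -mulr_natr natz.
Qed.

Lemma div0_valMz (D : Div0 V) (z : int) : div0_val (D *~ z) = div0_val D *~ z.
Proof. exact: (raddfMz (val : Div0 V -> divisor V)). Qed.

Lemma Jac_exponent (G : cmultigraph V) :
  exists2 N : nat, (0 < N)%N & forall a : Jac G, a *+ N = 0.
Proof.
pose M : 'M[int]_#|V| :=
  \matrix_(i, j) (laplacian G (enum_val i) (enum_val j) + 1).
pose vec (s : divisor V) : 'cV[int]_#|V| := \col_i s (enum_val i).
have ME s i : (M *m vec s) i 0 = lap_op G s (enum_val i) + divdeg s.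
  rewrite mxE ffunE /divdeg -big_split /= [RHS](reindex (fun i : 'I_#|V| => enum_val i)) /=; last first.
    exact/onW_bij/enum_val_bij.
  by apply: eq_bigr => j _; rewrite !mxE mulrDl mul1r.
have V_gt0 : (0 < #|V|)%N by case: G {M ME} => ? /andP[].
(* L + J, with J the all-ones matrix, is nonsingular as G is connected. *)
have sumM s c : (forall v, lap_op G s v + divdeg s = c v) ->
    divdeg s *+ #|V| = \sum_v c v.
  move=> sc; rewrite -(eq_bigr _ (fun v _ => sc v)) big_split /=.
  by rewrite -/(divdeg (lap_op G s)) divdeg_lap_op add0r sumr_const.
have Mker s : (forall v, lap_op G s v + divdeg s = 0) -> s = 0.
  move=> s0; have /eqP := sumM s _ s0.
  rewrite big1 // mulrn_eq0 eqn0Ngt V_gt0 /= => /eqP ds0.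
  have/lap_op_eq0 sc : lap_op G s = 0.
    by apply/ffunP=> v; have := s0 v; rewrite ds0 addr0 => ->; rewrite !ffunE.
  apply/ffunP=> v; rewrite ffunE; move/eqP: ds0; rewrite /divdeg.
  rewrite (eq_bigr (fun=> s v)) => [|w _]; last exact: sc.
  by rewrite sumr_const mulrn_eq0 eqn0Ngt V_gt0 => /eqP.
have MT : M^T = M.
  by apply/matrixP=> i j; rewrite !mxE laplacian_sym.
have detM : \det M != 0.
  apply/det0P => -[u u_neq0 uM]; case/eqP: u_neq0.
  pose s : divisor V := [ffun v => u 0 (enum_rank v)].
  have us : u^T = vec s.
    by apply/colP=> i; rewrite !mxE ffunE enum_valK.
  have s0 : s = 0.
    apply: Mker => v; rewrite -[v]enum_rankK -ME -us -MT -trmx_mul uM.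
    by rewrite !mxE.
  by apply/rowP=> i; have /colP/(_ i) := us; rewrite s0 !mxE ffunE.
exists `|\det M|%N => [|a]; first by rewrite absz_gt0.
have [D ->] := Jac_class_surj a.
suff: Jac_class G D *~ \det M = 0.
  case: (\det M) => k; rewrite ?NegzE ?mulrNz -?pmulrn //=.
  by move/eqP; rewrite oppr_eq0 => /eqP.
rewrite -raddfMz; apply/Jac_classP/asboolP.
pose u := \adj M *m vec (div0_val D).
pose s : divisor V := [ffun v => u (enum_rank v) 0].
have us : vec s = u by apply/colP=> i; rewrite !mxE ffunE enum_valK mxE.
have sE v : lap_op G s v + divdeg s = \det M * div0_val D v.
  rewrite -[v]enum_rankK -ME us mulmxA mul_mx_adj mul_scalar_mx.
  by rewrite !mxE.
have := sumM s _ sE; rewrite -mulr_sumr -/(divdeg _).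
have /eqP -> := div0P D; rewrite mulr0 => /eqP.
rewrite mulrn_eq0 eqn0Ngt V_gt0 /= => /eqP ds0.
exists s; apply/ffunP=> v; have := sE v; rewrite ds0 addr0 => ->.
by rewrite div0_valMz ffunMz mulrC.
Qed.

Lemma Jac_finite (G : cmultigraph V) :
  exists e : seq (Jac G), forall a : Jac G, a \in e.
Proof.
have [N N_gt0 NJ] := Jac_exponent G.
have /andP[/card_gt0P[v0 _] _] := cmultigraph_connected G.
pose g v : Jac G := Jac_class G (delta v0 v).
exists [seq \sum_v g v *+ f v | f : {ffun V -> 'I_N}] => a.
have [D ->] := Jac_class_surj a.
have DE : D = \sum_v delta v0 v *~ D v.
  apply: val_inj; rewrite raddf_sum /=; apply/ffunP=> w.
  rewrite sum_ffunE; under eq_bigr do rewrite div0_valMz ffunMz ffunE mulrBl.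
  rewrite sumrB -mulr_sumr -/(divdeg D) (eqP (div0P D)) mulr0 subr0.
  rewrite (bigD1 w) //= eqxx mul1r big1 ?addr0 // => v /negPf.
  by rewrite eq_sym => ->; rewrite mul0r.
have lt_mod v : (`|(D v %% N)%Z| < N)%N.
  by rewrite -ltz_nat gez0_abs ?modz_ge0 ?ltz_pmod // ?eqz_nat -?lt0n.
apply/imageP; exists [ffun v => Ordinal (lt_mod v)] => //.
rewrite {1}DE raddf_sum; apply: eq_bigr => v _.
rewrite raddfMz ffunE /= {1}(divz_eq (D v) N) mulrzDr mulrC mulrzA.
rewrite -/(g v) -pmulrn NJ mul0rz add0r pmulrn gez0_abs ?modz_ge0 //.
by rewrite eqz_nat -lt0n.
Qed.

HB.instance Definition _ (G : cmultigraph V) : isFinite (Jac G) :=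
  isFinite.Build (Jac G)
    (Finite.uniq_enumP (undup_uniq (projT1 (cid (Jac_finite G))))
       (fun a => etrans (mem_undup _ a) (projT2 (cid (Jac_finite G)) a))).
HB.instance Definition _ (G : cmultigraph V) :=
  [finGroupMixin of Jac G for +%R].
End Jacobian.

(* Main.v *)
(* Put b = delta x y. The Laplacians satisfy L1 s = L s + c (s y - s x) b with
   c = 1 or -1, so Jac G / <b> and Jac G1 / <b> are the same quotient, of order n
   say, and |Jac G| = n o, |Jac G1| = n o1 with o, o1 the orders of b. This gives
   the first divisibility and reduces the second to g | n for g = gcd(o, o1).
   Writing o b = L s, we have L1 s = (o + c (s y - s x)) b, so g | s y - s x.
   Then D |-> sum_v s v * D v mod g is trivial on principal divisors, as L is
   symmetric, and on b; minimality of o makes it surjective onto Z/g, so g | n. *)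
Require Import Defs.
From mathcomp Require Import all_boot all_order all_algebra all_fingroup.
From mathcomp Require Import boolp cyclic.

Set Implicit Arguments.
Unset Strict Implicit.
Unset Printing Implicit Defensive.
Import Order.TTheory GRing.Theory Num.Theory.
Local Open Scope ring_scope.

Lemma card_option_pred (T : finType) (P : pred (option T)) :
  #|[set e | P e]| = (P None + #|[set e | P (Some e)]|)%N.
Proof.
by rewrite !cardsE /= !cardE /enum_mem !size_filter [in LHS]unlock /= count_map.
Qed.

Lemma mult_add_edge (V : finType) (G : multigraph V) (x y : V)
    (neq_xy : x != y) v w :
  mult (add_edge G neq_xy) v w = (mult G v w + ([set v; w] == [set x; y]))%N.
Proof. by rewrite /mult card_option_pred addnC eq_sym. Qed.

Lemma mult_del_edge (V : finType) (G : multigraph V) (e : edge G) v w :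
  mult G v w = (mult (del_edge e) v w + ([set v; w] == ends e))%N.
Proof.
rewrite /mult (cardsD1 e) inE addnC [ends e == _]eq_sym; congr (_ + _)%N.
rewrite -(card_imset _ val_inj); congr #|pred_of_set _|; apply/setP=> f.
rewrite !inE; apply/andP/imsetP => [[fe vw]|[u + ->]].
  by exists (exist _ f fe); rewrite ?inE.
by rewrite inE => ?; split=> //; exact: valP u.
Qed.

(** One extra edge changes the Laplacian only at its ends, by [s x - s y] at [x] and the opposite at
    [y]. Phrasing this by multiplicities serves addition and, with the two graphs exchanged,
    deletion. *)
Lemma lap_op_succ_mult (V : finType) (G H : multigraph V) (x y : V)
    (neq_xy : x != y) :
    (forall v w, mult H v w = (mult G v w + ([set v; w] == [set x; y]))%N) ->
  forall s, lap_op H s = lap_op G s + div0_val (delta x y) *~ (s y - s x).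
Proof.
move=> HG s; apply/ffunP=> v; rewrite [RHS]ffunE ffunMz !laplacian_apply ffunE.
under eq_bigr do rewrite HG PoszD mulrDl; rewrite big_split /=; congr (_ + _).
have sum1 u z : \sum_w (w == z)%:Z * (s u - s w) = s u - s z.
  by rewrite (bigD1 z) //= eqxx mul1r big1 ?addr0 // => w /negPf->; rewrite mul0r.
have set2E w : ([set v; w] == [set x; y])
    = (v == x) && (w == y) || (v == y) && (w == x).
  apply/eqP/idP=> [/setP vw|/orP[]/andP[/eqP-> /eqP->] //]; last by rewrite setUC.
  have := vw v; have := vw w; have := vw x; have := vw y.
  rewrite !inE !eqxx !orbT /= [y == v]eq_sym [y == w]eq_sym.
  rewrite [x == v]eq_sym [x == w]eq_sym.
  have [->|nvx] := eqVneq v x; first by rewrite (negPf neq_xy) /= => ->.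
  by move=> _ /= -> _ /esym->.
have [vx|nvx] := eqVneq v x; last have [vy|nvy] := eqVneq v y.
- have vy : (v == y) = false by rewrite vx; apply: negPf.
  rewrite vy sub0r mulN1r opprB -sum1.
  by apply: eq_bigr => w _; rewrite set2E vx eqxx (negPf neq_xy) orbF.
- rewrite subr0 mul1r -sum1.
  by apply: eq_bigr => w _; rewrite set2E (negPf nvx) vy eqxx.
- rewrite subr0 mul0r big1 // => w _.
  by rewrite set2E (negPf nvx) (negPf nvy) mul0r.
Qed.

Lemma lap_op_self_adjoint (V : finType) (G : multigraph V) (s t : divisor V) :
  \sum_v s v * lap_op G t v = \sum_v lap_op G s v * t v.
Proof.
under eq_bigr do rewrite ffunE mulr_sumr.
under [RHS]eq_bigr do rewrite ffunE mulr_suml.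
rewrite exchange_big; apply: eq_bigr => v _; apply: eq_bigr => w _ /=.
by rewrite laplacian_sym mulrCA mulrA.
Qed.

Lemma sum_mul_delta (V : finType) (s : divisor V) (x y : V) :
  \sum_v s v * delta x y v = s y - s x.
Proof.
have sum1 z : \sum_v s v * (v == z)%:Z = s z.
  by rewrite (bigD1 z) //= eqxx mulr1 big1 ?addr0 // => v /negPf ->; rewrite mulr0.
by under eq_bigr do rewrite ffunE mulrBr; rewrite sumrB !sum1.
Qed.

Section JacobianClasses.
Variables (V : finType) (G : cmultigraph V).

Lemma Jac_class_eqP (D E : Div0 V) :
  Jac_class G D = Jac_class G E <->
  exists s : divisor V, div0_val D = div0_val E + lap_op G s.
Proof.
split=> [/eqP|[s DE]].
  rewrite -subr_eq0 -raddfB => /eqP/Jac_classP/asboolP[s DE].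
  exists s; rewrite -DE.
  by change (div0_val D = div0_val E + (div0_val D - div0_val E)); rewrite addrC subrK.
apply/eqP; rewrite -subr_eq0 -raddfB; apply/eqP/Jac_classP/asboolP; exists s.
by change (div0_val D - div0_val E = lap_op G s); rewrite DE addrC addKr.
Qed.

Lemma mem_cycleMz (a : Jac G) (k : int) : a *~ k \in <[a]>%g.
Proof.
case: k => k; rewrite ?NegzE ?mulrNz -pmulrn -FinRing.zmodXgE ?mem_cycle //.
by rewrite -FinRing.zmodVgE groupV mem_cycle.
Qed.

Lemma order_dvd_laplacian (D : Div0 V) (k : int) (s : divisor V) :
  div0_val D *~ k = lap_op G s -> (#[Jac_class G D]%g %| k)%Z.
Proof.
move=> Dk; have : Jac_class G D *~ k = 0.
  rewrite -raddfMz; apply/Jac_classP/asboolP; exists s.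
  by rewrite div0_valMz.
rewrite dvdzE /= order_dvdn FinRing.zmodXgE.
case: k {Dk} => k /=; rewrite ?NegzE ?mulrNz -?pmulrn => /eqP //.
by rewrite oppr_eq0.
Qed.

(** The index is the order of the quotient by [<[a]>], so it kills the coset of [b]. *)
Lemma mulrn_index_cycle (a b : Jac G) :
  exists k, b *+ #|[set: Jac G] : <[a]>%g|%g = a *+ k.
Proof.
have aN : [set: Jac G] \subset 'N(<[a]>)%g.
  by apply/sub_abelian_norm/subsetT; apply: FinRing.zmod_abelian.
rewrite -(card_quotient aN) -!FinRing.zmodXgE; apply/cycleP.
have bN : b \in 'N(<[a]>)%g by rewrite (subsetP aN) ?inE.
rewrite coset_idr ?groupX // morphX //.
by apply/eqP; rewrite -order_dvdn order_dvdG // mem_quotient ?inE.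
Qed.

(** The map to Z/g is not built: pairing with [s] shows that [g] divides each [n * (s v - s x)], and
    minimality of the order of [d] then forces g to divide [n]. *)
Lemma dvd_index_delta (x y : V) (s : divisor V) (g : nat) :
    let d := Jac_class G (delta x y) in
    div0_val (delta x y) *~ #[d]%g = lap_op G s ->
    (g %| #[d]%g)%N -> (g %| s y - s x)%Z ->
  (g %| #|[set: Jac G] : <[d]>|%g)%N.
Proof.
move=> d ds gd gs; set n := #|_ : _|%g.
have g_gt0 : (0 < g)%N by apply: dvdn_gt0 gd; apply: order_gt0.
(* Modulo the image of L, [n] times [delta x v] is [k] times [delta x y]. Pair this with [s]:
   self-adjointness turns the term in L t into #[d] (t y - t x). *)
have gn v : (g %| n%:Z * (s v - s x))%Z.
  have [k] := mulrn_index_cycle d (Jac_class G (delta x v)).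
  rewrite -/n -!raddfMn => /Jac_class_eqP[t].
  rewrite !pmulrn !div0_valMz => tE.
  have -> : n%:Z * (s v - s x)
      = k%:Z * (s y - s x) + #[d]%g%:Z * (t y - t x).
    rewrite -!sum_mul_delta !mulr_sumr.
    have -> : \sum_i #[d]%g%:Z * (t i * delta x y i)
        = \sum_i lap_op G s i * t i.
      apply: eq_bigr => i _; rewrite -ds ffunMz.
      by rewrite mulrCA [RHS]mulrC mulrA mulrAC mulrA mulrC.
    rewrite -lap_op_self_adjoint -big_split /=; apply: eq_bigr => i _.
    have := congr1 (fun D : divisor V => D i) tE.
    rewrite !ffunE !ffunMz /= !ffunE => tiE.
    by rewrite mulrCA [n%:Z * _]mulrC tiE mulrDr [_ * k%:Z]mulrC mulrCA.
  by apply: rpredD; [exact: dvdz_mull | exact: dvdz_mulr].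
(* [q] is the part of [g] missing from [n]; it divides every [s v - s x], and the goal becomes [q] =
   1. *)
pose q := (g %/ gcdn g n)%N.
have qs v : (q %| s v - s x)%Z.
  move: (gn v); rewrite !dvdzE /= abszM => gnv.
  have := dvdn_gcd g (g * `|s v - s x|) (n * `|s v - s x|).
  rewrite gnv dvdn_mulr // -muln_gcdl -{1}(divnK (dvdn_gcdl g n)) mulnC.
  by rewrite dvdn_pmul2l // gcdn_gt0 g_gt0.
have q_gt0 : (0 < q)%N by rewrite divn_gt0 ?gcdn_gt0 ?g_gt0 // dvdn_leq ?dvdn_gcdl.
have qg : (q %| g)%N by apply/dvdnP; exists (gcdn g n); rewrite mulnC divnK ?dvdn_gcdl.
pose o' := (#[d]%g %/ q)%N.
have o'q : (o' * q)%N = #[d]%g by rewrite divnK // (dvdn_trans qg).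
(* The division is exact and L ignores constants, so q L t = L s. Hence [o'] = #[d] / q already
   kills [d], and #[d] divides [o']. *)
pose t : divisor V := [ffun v => ((s v - s x) %/ q)%Z].
have : (#[d]%g %| o'%:Z)%Z.
  apply: (@order_dvd_laplacian _ _ t); apply/ffunP=> v; rewrite ffunMz.
  apply: (@mulIf _ q%:Z); first by rewrite eqz_nat -lt0n.
  rewrite -mulrA -PoszM o'q -ffunMz ds !laplacian_apply mulr_suml.
  apply: eq_bigr => w _; rewrite -mulrA; congr (_ * _).
  by rewrite !ffunE mulrBl !divzK // opprB addrA subrK.
rewrite dvdzE /= -{1}o'q -{2}[o']muln1 dvdn_pmul2l; last first.
  by rewrite -(@ltn_pmul2r q) // o'q mul0n order_gt0.
rewrite dvdn1 => /eqP q1.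
by rewrite -(divnK (dvdn_gcdl g n)) -/q q1 mul1n dvdn_gcdr.
Qed.

End JacobianClasses.

(** Principal divisors of [G] fall into the subgroup generated by [D] in the Jacobian of [G1]. So
    Jac G maps onto the quotient by that subgroup, with the class of [D] in the kernel. *)
Lemma index_delta_dvd (V : finType) (G G1 : cmultigraph V) (D : Div0 V) :
    (forall s, exists k : int, lap_op G s = lap_op G1 s + div0_val D *~ k) ->
  (#|[set: Jac G1] : <[Jac_class G1 D]>|%g
     %| #|[set: Jac G] : <[Jac_class G D]>|%g)%N.
Proof.
move=> GG1; set H1 := <[_]>%g.
have H1N a : a \in 'N(H1)%g.
  apply: subsetP (in_setT a); apply/sub_abelian_norm/subsetT.
  exact: FinRing.zmod_abelian.
(* Defined on chosen representatives; [fE] shows that the choice does not matter. *)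
pose f (a : Jac G) := coset H1 (Jac_class G1 (generic_quotient.repr a)).
have fE E : f (Jac_class G E) = coset H1 (Jac_class G1 E).
  have /Jac_class_eqP[s] :
      Jac_class G (generic_quotient.repr (Jac_class G E)) = Jac_class G E.
    by rewrite /Jac_class generic_quotient.reprK.
  rewrite /f; move: (generic_quotient.repr _) => F FE.
  have [k ks] := GG1 s.
  have -> : Jac_class G1 F = Jac_class G1 (D *~ k + E).
    apply/Jac_class_eqP; exists s; rewrite FE ks.
    change (div0_val E + (lap_op G1 s + div0_val D *~ k)
      = div0_val (D *~ k) + div0_val E + lap_op G1 s).
    by rewrite div0_valMz addrCA addrC [_ + div0_val D *~ k]addrC.
  rewrite raddfD raddfMz -FinRing.zmodMgE morphM ?H1N //= coset_id ?mul1g //.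
  exact: mem_cycleMz.
have fM : {in [set: Jac G] &, {morph f : a b / (a * b)%g}}.
  move=> a b _ _; have [A ->] := Jac_class_surj a; have [B ->] := Jac_class_surj b.
  by rewrite FinRing.zmodMgE -raddfD !fE raddfD -FinRing.zmodMgE morphM ?H1N.
pose phi := Morphism fM.
have <- : #|(phi @* [set: Jac G])%g| = #|[set: Jac G1] : H1|%g.
  rewrite -card_quotient; last by apply/subsetP=> a _; apply: H1N.
  congr #|pred_of_set _|; apply/eqP; rewrite eqEsubset; apply/andP; split.
    apply/subsetP=> _ /morphimP[a _ _ ->] /=.
    by rewrite mem_quotient ?inE.
  apply/subsetP=> _ /morphimP[b _ _ ->] /=.
  have [B ->] := Jac_class_surj b.
  by rewrite -fE; apply: (mem_morphim phi); rewrite inE.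
rewrite card_morphim setIid; apply: indexgS.
rewrite cycle_subG; apply/kerP; rewrite ?inE //= fE.
by rewrite coset_id ?cycle_id.
Qed.

(** The sign [c] treats addition and deletion at once. *)
Lemma index_gcd_Jac (V : finType) (G G1 : cmultigraph V) (x y : V) (c : int) :
    c * c = 1 ->
    (forall s, lap_op G1 s
       = lap_op G s + div0_val (delta x y) *~ (c * (s y - s x))) ->
  let index := #|[set: Jac G] : <[Jac_class G (delta x y)]>|%g in
  (index %| gcdn #|[set: Jac G]| #|[set: Jac G1]|)%N /\
  (gcdn #|[set: Jac G]| #|[set: Jac G1]| %| index ^ 2)%N.
Proof.
move=> c1 GG1 n.
set d := Jac_class G (delta x y) in n *.
pose d1 := Jac_class G1 (delta x y).
(* The Laplacian relation can be read in both directions, so each index divides the other. *)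
have n1 : #|[set: Jac G1] : <[d1]>|%g = n.
  apply/eqP; rewrite eqn_dvd; apply/andP; split; apply: index_delta_dvd => s.
    by exists (- (c * (s y - s x))); rewrite GG1 mulrNz addrK.
  by exists (c * (s y - s x)).
have cardJ : #|[set: Jac G]| = (n * #[d]%g)%N by rewrite mulnC Lagrange ?subsetT.
have cardJ1 : #|[set: Jac G1]| = (n * #[d1]%g)%N.
  by rewrite -n1 mulnC Lagrange ?subsetT.
rewrite cardJ cardJ1 -muln_gcdr; split; first exact: dvdn_mulr.
rewrite -mulnn dvdn_mul //.
have [s ds] : exists s, div0_val (delta x y) *~ #[d]%g = lap_op G s.
  rewrite -div0_valMz; apply/asboolP/Jac_classP.
  by rewrite raddfMz -pmulrn -FinRing.zmodXgE expg_order.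
apply: (dvd_index_delta ds); first exact: dvdn_gcdl.
have d1s : (#[d1]%g %| #[d]%g%:Z + c * (s y - s x))%Z.
  by apply: (@order_dvd_laplacian _ _ _ _ s); rewrite GG1 mulrzDr ds.
(* As [c] is its own inverse, it suffices to divide [c * (s y - s x)], which is the sum in [d1s]
   minus #[d]. *)
rewrite -[s y - s x]mul1r -c1 -mulrA dvdz_mull //.
rewrite -[_ * _](addKr #[d]%g%:Z) rpredD ?rpredN //; first exact: dvdn_gcdl.
by apply: dvdz_trans d1s; exact: dvdn_gcdr.
Qed.

Theorem theorem1p1 (V : finType) (G G1 : cmultigraph V) (x y : V)
    (neq_xy : x != y)
    (G1_def : cmultigraph_graph G1 = add_edge G neq_xy \/
              exists2 e : edge G, ends e = [set x; y] &
                cmultigraph_graph G1 = del_edge e) :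
  let index := #|[set: Jac G] : <[Jac_class G (delta x y)]>|%g in
  (index %| gcdn #|[set: Jac G]| #|[set: Jac G1]|)%N /\
  (gcdn #|[set: Jac G]| #|[set: Jac G1]| %| index ^ 2)%N.
Proof.
case: G1_def => [G1E|[e exy G1E]].
  apply: (@index_gcd_Jac _ _ _ _ _ 1) => // s; rewrite mul1r.
  by apply: lap_op_succ_mult => // v w; rewrite G1E mult_add_edge.
(* Here [G] is the graph with the extra edge, so the correction changes sign. *)
apply: (@index_gcd_Jac _ _ _ _ _ (-1)) => // s.
rewrite mulN1r mulrNz; apply/esym/(canLR (addrK _)).
by apply: lap_op_succ_mult => // v w; rewrite (mult_del_edge e) G1E exy.
Qed.
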